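(* Let $G$ be one of the 4-dimensional simply connected unimodular Lie groups $\mathrm{Nil}^4$, $\mathrm{Sol}_1^4$, $\mathrm{Sol}_{m,n}^4$, with Lie algebra $\mathfrak g$, endowed with a left-invariant metric in the normal form given by an orthonormal basis $\{E_1,E_2,E_3,E_4\}$ of $\mathfrak g$ with metric coefficients $d_i$ (as specified in the context), and let $\mathfrak h\subset\mathfrak g$ be a 3-dimensional linear subspace. Then: (1) If $G=\mathrm{Nil}^4$, then $\mathfrak h$ is a subalgebra of $\mathfrak g$ if and only if $\mathfrak h=\mathrm{span}\{E_1,E_2,aE_3+bE_4\}$ for some $a,b\in\mathbb R$ not both zero. (2) If $G=\mathrm{Sol}_1^4$, then $\mathfrak h$ is a subalgebra of $\mathfrak g$ if and only if, up to conjugacy, it is one of (a) $\mathfrak h_0=\mathrm{span}\{E_1,E_2,E_3\}$; (b) $\mathfrak h_1=\mathrm{span}\{E_1,E_2,E_4\}$; (c) $\mathfrak h_2=\mathrm{span}\Big\{E_1,E_4,\frac{1}{\sqrt{d_4^2+1}}(d_4E_2-E_3)\Big\}$. (3) If $G=\mathrm{Sol}_{m,n}^4$, then $\mathfrak h$ is a subalgebra of $\mathfrak g$ if and only if, up to conjugacy, it is one of (a) $\mathfrak h_0=\mathrm{span}\{E_1,E_2,E_3\}$; (b) $\mathfrak h_1=\mathrm{span}\{E_1,E_2,E_4\}$; (c) $\mathfrak h_2=\mathrm{span}\{E_1,\ d_3E_2-E_3,\ E_4\}$; (d) $\mathfrak h_3=\mathrm{span}\{d_1E_1-E_2,\ d_2E_1-E_3,\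 E_4\}$.
   Context: Two subalgebras $\mathfrak h,\mathfrak h'$ of $\mathfrak g$ are conjugate if $\mathfrak h'=\mathrm{Ad}(x)\mathfrak h$ for some $x\in G$ (for example $\mathrm{Ad}(\exp X)=e^{\mathrm{ad}(X)}$, $X\in\mathfrak g$). The Lie algebras are given by a basis $\{e_1,e_2,e_3,e_4\}$ with the following nonzero brackets (all other brackets of basis vectors $e_i,e_j$, $i<j$, vanish), and the orthonormal basis $\{E_i\}$ defining the left-invariant metric is as follows. - $\mathrm{Nil}^4$ (also written $\mathrm{Nil}_4$): $[e_2,e_4]=e_1$, $[e_3,e_4]=e_2$. Orthonormal basis: $E_1=d_1e_1$, $E_2=d_2e_1+d_3e_2$, $E_3=e_3$, $E_4=e_4$, where $d_1,d_3>0$, $d_2\ge 0$. - $\mathrm{Sol}_1^4$: $[e_2,e_3]=e_1$, $[e_2,e_4]=-e_2$, $[e_3,e_4]=e_3$. Orthonormal basis: $E_1=d_1e_1$, $E_2=d_2e_1+e_2$, $E_3=d_3e_1+d_4e_2+e_3$, $E_4=d_5e_4$, where $d_1,d_5>0$, $d_2,d_4\ge 0$, $d_3\in\mathbb R$. - $\mathrm{Sol}_{m,n}^4$ (also written $\mathrm{Sol}_\lambda^4$): $[e_1,e_4]=-\lambda e_1$, $[e_2,e_4]=-e_2$, $[e_3,e_4]=(\lambda+1)e_3$, where $\lambda>1$ is the real parameter attached to integers $m,n$ such that $x^3-mx^2+nx-1=0$ has three distinct positive real roots $\alpha_1>\alpha_2>\alpha_3$, $\lambda=\ln\alpha_1/\ln\alpha_2$.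 Orthonormal basis: $E_1=e_1$, $E_2=d_1e_1+e_2$, $E_3=d_2e_1+d_3e_2+e_3$, $E_4=d_4e_4$, where $d_4>0$, $d_1,d_3\ge 0$, $d_2\in\mathbb R$. By a known result, every left-invariant metric on these groups is isometric to one of those above. *)

(* Defs.v *)
From HB Require Import structures.
From mathcomp Require Import all_boot all_order all_algebra.
From mathcomp Require Import all_classical all_reals all_analysis.

Set Implicit Arguments.
Unset Strict Implicit.
Unset Printing Implicit Defensive.

Import Order.TTheory GRing.Theory Num.Theory numFieldNormedType.Exports.

Local Open Scope classical_set_scope.
Local Open Scope ring_scope.

(* Lie groups are given as closed matrix groups G, so that tangent vectors are
   matrices, the Lie bracket is the commutator, and Ad is conjugation. For the
   three groups below (t, a, b, c) is a global chart, so that they are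
   diffeomorphic to R^4 and in particular simply connected. *)

Definition lie {R : realType} {n : nat} (X Y : 'M[R]_n) : 'M[R]_n :=
  X *m Y - Y *m X.

Definition Ad {R : realType} {n : nat} (x X : 'M[R]_n) : 'M[R]_n :=
  x *m X *m invmx x.

(* The tangent space of G at the identity: velocities at time 0 of the curves
   in G that start at the identity. For a closed G, differentiability of the
   curve at 0 is enough. *)
Definition lie_algebra {R : realType} {n : nat} (G : set 'M[R]_n) :
    set 'M[R]_n :=
  [set X | exists c : R -> 'M[R]_n,
     [/\ forall t, G (c t), c 0 = 1%:M & is_derive (0 : R) (1 : R) c X]].

Definition subalgebra {R : realType} {n : nat} (h : {vspace 'M[R]_n}) : Prop :=
  forall X Y, X \in h -> Y \in h -> lie X Y \in h.

Definition conjugate {R : realType} {n : nat} (G : set 'M[R]_n)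
    (h h' : {vspace 'M[R]_n}) : Prop :=
  exists2 x, G x & [set` h'] = Ad x @` [set` h].

(* A left-invariant metric on a Lie group is the same thing as an inner product
   on its Lie algebra g. *)
Definition left_invariant_metric {R : realType} {n : nat}
  (g : {vspace 'M[R]_n}) := {dot subvs_of g for idfun}.

Definition orthonormal_basis {R : realType} {n : nat} (g : {vspace 'M[R]_n})
    (rho : left_invariant_metric g) (E : seq 'M[R]_n) : Prop :=
  basis_of g E /\ orthonormal rho [seq vsproj g X | X <- E].

Definition mx_of_rows {R : realType} {n : nat} (s : seq (seq R)) : 'M[R]_n :=
  \matrix_(i < n, j < n) (nth [::] s i)`_j.

(* The semidirect product of R^3 by R, where t in R acts by exp(tL) for the
   nilpotent Jordan block L of size 3, as affine transformations of R^3. *)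
Definition Nil4 (R : realType) : set 'M[R]_4 :=
  [set x | exists t a b c : R, x = mx_of_rows
     [:: [:: 1; t; t ^+ 2 / 2; a];
         [:: 0; 1; t;          b];
         [:: 0; 0; 1;          c];
         [:: 0; 0; 0;          1]]].

(* The semidirect product of the Heisenberg group by R. *)
Definition Sol1 (R : realType) : set 'M[R]_3 :=
  [set x | exists t a b c : R, x = mx_of_rows
     [:: [:: 1; a;      c];
         [:: 0; expR t; b];
         [:: 0; 0;      1]]].

(* The semidirect product of R^3 by R, where t in R acts by
   diag(e^(lambda t), e^t, e^(-(lambda + 1) t)), as affine transformations of
   R^3. *)
Definition Sollam (R : realType) (lambda : R) : set 'M[R]_4 :=
  [set x | exists t a b c : R, x = mx_of_rows
     [:: [:: expR (lambda * t); 0;      0;                          a];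
         [:: 0;                 expR t; 0;                          b];
         [:: 0;                 0;      expR (- ((lambda + 1) * t)); c];
         [:: 0;                 0;      0;                          1]]].

Definition Nil4_brackets {R : realType} {n : nat} (e1 e2 e3 e4 : 'M[R]_n) :=
  (lie e1 e2 = 0 /\ lie e1 e3 = 0 /\ lie e1 e4 = 0) /\
  (lie e2 e3 = 0 /\ lie e2 e4 = e1 /\ lie e3 e4 = e2).

Definition Sol1_brackets {R : realType} {n : nat} (e1 e2 e3 e4 : 'M[R]_n) :=
  (lie e1 e2 = 0 /\ lie e1 e3 = 0 /\ lie e1 e4 = 0) /\
  (lie e2 e3 = e1 /\ lie e2 e4 = - e2 /\ lie e3 e4 = e3).

Definition Sollam_brackets {R : realType} {n : nat} (lambda : R)
    (e1 e2 e3 e4 : 'M[R]_n) :=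
  (lie e1 e2 = 0 /\ lie e1 e3 = 0 /\ lie e1 e4 = - (lambda *: e1)) /\
  (lie e2 e3 = 0 /\ lie e2 e4 = - e2 /\ lie e3 e4 = (lambda + 1) *: e3).

(* lambda is the parameter attached to the integers m and n; note that
   lambda > 1 forces alpha2 > 1, so the quotient of logarithms is a genuine
   one. *)
Definition Solmn_parameter {R : realType} (m n : int) (lambda : R) : Prop :=
  exists alpha1 alpha2 alpha3 : R,
    let p : {poly R} := 'X^3 - m%:~R *: 'X^2 + n%:~R *: 'X - 1 in
    [/\ alpha1 > alpha2 /\ alpha2 > alpha3, alpha3 > 0,
        [/\ root p alpha1, root p alpha2 & root p alpha3],
        lambda = ln alpha1 / ln alpha2 & lambda > 1].

(* Main.v *)
(* A hyperplane h of g is the kernel of a linear form f, and h is a subalgebra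
   iff the 3-form f /\ df vanishes. In the coordinates f = (f1, f2, f3, f4) dual
   to (e1, e2, e3, e4) this reads f1 = f2 = 0 for Nil^4, f1 = f2 f3 = 0 for
   Sol_1^4, and f1 f2 = f1 f3 = f2 f3 = 0 for Sol_{m,n}^4, because lambda > 1.
   In the last two cases, if f_k <> 0 with k <= 3, then exp (ad (s e_k)) removes
   the e4-component of f for a suitable s, which leaves finitely many kernels.
   Since e_k lies in [g, g], it is a nilpotent matrix and exp (s e_k) is an
   element of G given by a quadratic polynomial. *)

Require Import Defs.
From HB Require Import structures.
From mathcomp Require Import all_boot all_order all_algebra.
From mathcomp Require Import all_classical all_reals all_analysis.
From mathcomp Require Import ring lra.

Import Order.TTheory GRing.Theory Num.Theory numFieldNormedType.Exports.

Local Open Scope classical_set_scope.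
Local Open Scope ring_scope.

(** * Spans of three vectors and hyperplanes of a four-dimensional space *)

Lemma mem_span3 {K : fieldType} {V : vectType K} (u v w X : V) :
  X \in <<[:: u; v; w]>>%VS <->
  exists a b c : K, X = a *: u + b *: v + c *: w.
Proof.
rewrite !span_cons span_nil addv0; split.
  case/memv_addP=> _ /vlineP[a ->] [_ /memv_addP[_ /vlineP[b ->]
    [_ /vlineP[c ->] ->]] ->].
  by exists a, b, c; rewrite addrA.
case=> a [b [c ->]]; rewrite -addrA.
by rewrite !memv_add ?memvZ ?memv_line.
Qed.

Lemma span3_subv {K : fieldType} {V : vectType K} (u v w : V) (U : {vspace V}) :
  u \in U -> v \in U -> w \in U -> (<<[:: u; v; w]>> <= U)%VS.
Proof.
by move=> uU vU wU; apply/span_subvP => x; rewrite !inE => /or3P[] /eqP->.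
Qed.

(** A lower triangular change of generators with nonzero diagonal is undone by forward substitution.
    This is how spans of the [E_i] are rewritten as spans of the [e_i]. *)
Lemma span3_triangular {K : fieldType} {V : vectType K} {u v w : V}
    {k1 k2 k3 a b c : K} {u' v' w' : V} :
  k1 != 0 -> k2 != 0 -> k3 != 0 ->
  u' = k1 *: u -> v' = a *: u + k2 *: v -> w' = b *: u + c *: v + k3 *: w ->
  <<[:: u'; v'; w']>>%VS = <<[:: u; v; w]>>%VS.
Proof.
move=> k1N0 k2N0 k3N0 u'E v'E w'E; apply/eqP; rewrite eqEsubv; apply/andP; split.
  apply: span3_subv; apply/mem_span3.
  - by exists k1, 0, 0; rewrite !scale0r !addr0.
  - by exists a, k2, 0; rewrite scale0r addr0.
  - by exists b, c, k3.
set U := <<[:: u'; v'; w']>>%VS.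
have [u'U v'U w'U] : [/\ u' \in U, v' \in U & w' \in U].
  by split; apply: memv_span; rewrite !inE ?eqxx ?orbT.
have uU : u \in U by rewrite -[u](scalerK k1N0) -u'E memvZ.
have vU : v \in U.
  have -> : v = k2^-1 *: (v' - a *: u) by rewrite v'E addrC addKr scalerK.
  by rewrite memvZ// memvB// memvZ.
have wU : w \in U.
  have -> : w = k3^-1 *: (w' - (b *: u + c *: v)).
    by rewrite w'E [_ + k3 *: w]addrC addrK scalerK.
  by rewrite memvZ// memvB// memvD// memvZ.
exact: span3_subv.
Qed.

Definition comb4 {K : fieldType} {V : vectType K} (e1 e2 e3 e4 : V)
    (x1 x2 x3 x4 : K) : V :=
  x1 *: e1 + x2 *: e2 + x3 *: e3 + x4 *: e4.

Lemma basis4P {K : fieldType} {V : vectType K} {g : {vspace V}}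
    {e1 e2 e3 e4 X : V} :
  basis_of g [:: e1; e2; e3; e4] -> X \in g ->
  exists x1 x2 x3 x4, X = comb4 e1 e2 e3 e4 x1 x2 x3 x4.
Proof.
move=> /span_basis <-; rewrite !span_cons span_nil addv0.
case/memv_addP=> _ /vlineP[x1 ->] [_ /memv_addP[_ /vlineP[x2 ->]
  [_ /memv_addP[_ /vlineP[x3 ->] [_ /vlineP[x4 ->] ->]] ->]] ->].
by exists x1, x2, x3, x4; rewrite /comb4 !addrA.
Qed.

(** For [v] in [g] outside [h], counting dimensions gives [g = h + <[v]>]. Then [f_i] is the
    coefficient of [v] in [e_i] modulo [h]; if all the [f_i] vanished, [v] itself would lie in
    [h]. *)
Lemma hyperplane_covector {K : fieldType} {V : vectType K} {g h : {vspace V}}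
    {e1 e2 e3 e4 : V} :
  basis_of g [:: e1; e2; e3; e4] -> (h <= g)%VS -> \dim h = 3%N ->
  exists f1 f2 f3 f4 : K,
    ~ [/\ f1 = 0, f2 = 0, f3 = 0 & f4 = 0] /\
    forall x1 x2 x3 x4, (comb4 e1 e2 e3 e4 x1 x2 x3 x4 \in h) =
      (x1 * f1 + x2 * f2 + x3 * f3 + x4 * f4 == 0).
Proof.
move=> eB hg dimh.
have dimg : \dim g = 4%N by exact: (size_basis (X := [tuple e1; e2; e3; e4]) eB).
have /subvPn[v vg vNh] : ~~ (g <= h)%VS.
  by apply/negP => /dimvS; rewrite dimg dimh.
have gE : g = (h + <[v]>)%VS.
  apply/esym/eqP; rewrite eqEdim subv_add hg -memvE vg /=.
  have /dimv_disjoint_sum-> : (h :&: <[v]> = 0)%VS.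
    apply/eqP; rewrite -subv0; apply/subvP => x /memv_capP[xh /vlineP[k xE]].
    rewrite memv0 xE scaler_eq0; apply/orP; left; apply: contraNT vNh => kN0.
    by rewrite -[v](scalerK kN0) -xE memvZ.
  rewrite dimg dimh dim_vline; case: eqVneq vNh => // ->.
  by rewrite mem0v.
have dec e : e \in g -> exists k, e - k *: v \in h.
  rewrite gE => /memv_addP[u uh [_ /vlineP[k ->] ->]].
  by exists k; rewrite addrK.
have [[e1g e2g] [e3g e4g]] : (e1 \in g /\ e2 \in g) /\ (e3 \in g /\ e4 \in g).
  by do !split; apply: (basis_mem eB); rewrite !inE eqxx ?orbT.
have [[f1 f1h] [f2 f2h]] := (dec _ e1g, dec _ e2g).
have [[f3 f3h] [f4 f4h]] := (dec _ e3g, dec _ e4g).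
have memE x1 x2 x3 x4 : (comb4 e1 e2 e3 e4 x1 x2 x3 x4 \in h) =
      (x1 * f1 + x2 * f2 + x3 * f3 + x4 * f4 == 0).
  (* Splitting each [e_i] leaves an element of [h] plus the multiple f(x) of [v], which lies in [h]
     only if f(x) = 0. *)
  have -> : comb4 e1 e2 e3 e4 x1 x2 x3 x4 =
      comb4 (e1 - f1 *: v) (e2 - f2 *: v) (e3 - f3 *: v) (e4 - f4 *: v)
        x1 x2 x3 x4 + (x1 * f1 + x2 * f2 + x3 * f3 + x4 * f4) *: v.
    have split_term x f e : x *: e = x *: (e - f *: v) + (x * f) *: v.
      by rewrite scalerBr scalerA subrK.
    rewrite /comb4 {1}(split_term x1 f1) {1}(split_term x2 f2).
    rewrite {1}(split_term x3 f3) {1}(split_term x4 f4).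
    rewrite (addrACA _ ((x1 * f1) *: v)) -scalerDl.
    rewrite (addrACA _ ((x1 * f1 + x2 * f2) *: v)) -scalerDl.
    by rewrite (addrACA _ ((x1 * f1 + x2 * f2 + x3 * f3) *: v)) -scalerDl.
  rewrite rpredDl; last by rewrite /comb4 !rpredD ?rpredZ.
  apply/idP/eqP => [kvh|->]; last by rewrite scale0r mem0v.
  by apply: contraNeq vNh => kN0; rewrite -[v](scalerK kN0) memvZ.
exists f1, f2, f3, f4; split=> // -[f10 f20 f30 f40].
case/negP: vNh; have [x1 [x2 [x3 [x4 ->]]]] := basis4P eB vg.
by rewrite memE f10 f20 f30 f40 !mulr0 !addr0.
Qed.

(** * The commutator bracket in coordinates *)

Lemma lieZl {R : realType} {n : nat} a (X Y : 'M[R]_n) :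
  lie (a *: X) Y = a *: lie X Y.
Proof. by rewrite /lie -scalemxAl -scalemxAr scalerBr. Qed.

Lemma lieC {R : realType} {n : nat} (X Y : 'M[R]_n) : lie X Y = - lie Y X.
Proof. by rewrite /lie opprB. Qed.

Lemma lieZr {R : realType} {n : nat} a (X Y : 'M[R]_n) :
  lie X (a *: Y) = a *: lie X Y.
Proof. by rewrite lieC lieZl -scalerN -lieC. Qed.

Lemma lieDl {R : realType} {n : nat} (X X' Y : 'M[R]_n) :
  lie (X + X') Y = lie X Y + lie X' Y.
Proof. by rewrite /lie mulmxDl mulmxDr opprD addrACA. Qed.

Lemma lieDr {R : realType} {n : nat} (X Y Y' : 'M[R]_n) :
  lie X (Y + Y') = lie X Y + lie X Y'.
Proof. by rewrite lieC lieDl opprD -!lieC. Qed.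

Lemma liexx {R : realType} {n : nat} (X : 'M[R]_n) : lie X X = 0.
Proof. exact: subrr. Qed.

Lemma lie_comb4 {R : realType} {n : nat} (e1 e2 e3 e4 : 'M[R]_n)
    (x1 x2 x3 x4 y1 y2 y3 y4 : R) :
  lie (comb4 e1 e2 e3 e4 x1 x2 x3 x4) (comb4 e1 e2 e3 e4 y1 y2 y3 y4) =
    (x1 * y2 - x2 * y1) *: lie e1 e2 + (x1 * y3 - x3 * y1) *: lie e1 e3 +
    (x1 * y4 - x4 * y1) *: lie e1 e4 + (x2 * y3 - x3 * y2) *: lie e2 e3 +
    (x2 * y4 - x4 * y2) *: lie e2 e4 + (x3 * y4 - x4 * y3) *: lie e3 e4.
Proof.
rewrite /comb4 !(lieDl, lieDr, lieZl, lieZr) !liexx.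
rewrite (lieC e2 e1) (lieC e3 e1) (lieC e4 e1) (lieC e3 e2) (lieC e4 e2).
rewrite (lieC e4 e3).
move: (lie e1 e2) (lie e1 e3) (lie e1 e4) (lie e2 e3) (lie e2 e4) (lie e3 e4).
by move=> e12 e13 e14 e23 e24 e34; apply/matrixP => i j; rewrite !mxE; ring.
Qed.

Lemma Nil4_lie {R : realType} {n : nat} {e1 e2 e3 e4 : 'M[R]_n}
    {x1 x2 x3 x4 y1 y2 y3 y4 : R} :
  Nil4_brackets e1 e2 e3 e4 ->
  lie (comb4 e1 e2 e3 e4 x1 x2 x3 x4) (comb4 e1 e2 e3 e4 y1 y2 y3 y4) =
    comb4 e1 e2 e3 e4 (x2 * y4 - x4 * y2) (x3 * y4 - x4 * y3) 0 0.
Proof.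
move=> [[e12 [e13 e14]] [e23 [e24 e34]]]; rewrite lie_comb4.
rewrite e12 e13 e14 e23 e24 e34 /comb4.
by apply/matrixP => i j; rewrite !mxE; ring.
Qed.

Lemma Sol1_lie {R : realType} {n : nat} {e1 e2 e3 e4 : 'M[R]_n}
    {x1 x2 x3 x4 y1 y2 y3 y4 : R} :
  Sol1_brackets e1 e2 e3 e4 ->
  lie (comb4 e1 e2 e3 e4 x1 x2 x3 x4) (comb4 e1 e2 e3 e4 y1 y2 y3 y4) =
    comb4 e1 e2 e3 e4
      (x2 * y3 - x3 * y2) (x4 * y2 - x2 * y4) (x3 * y4 - x4 * y3) 0.
Proof.
move=> [[e12 [e13 e14]] [e23 [e24 e34]]]; rewrite lie_comb4.
rewrite e12 e13 e14 e23 e24 e34 /comb4.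
by apply/matrixP => i j; rewrite !mxE; ring.
Qed.

Lemma Sollam_lie {R : realType} {n : nat} {lambda : R} {e1 e2 e3 e4 : 'M[R]_n}
    {x1 x2 x3 x4 y1 y2 y3 y4 : R} :
  Sollam_brackets lambda e1 e2 e3 e4 ->
  lie (comb4 e1 e2 e3 e4 x1 x2 x3 x4) (comb4 e1 e2 e3 e4 y1 y2 y3 y4) =
    comb4 e1 e2 e3 e4 (lambda * (x4 * y1 - x1 * y4)) (x4 * y2 - x2 * y4)
      ((lambda + 1) * (x3 * y4 - x4 * y3)) 0.
Proof.
move=> [[e12 [e13 e14]] [e23 [e24 e34]]]; rewrite lie_comb4.
rewrite e12 e13 e14 e23 e24 e34 /comb4.
by apply/matrixP => i j; rewrite !mxE; ring.
Qed.

(** * Subalgebras and conjugation by [Ad] *)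

Lemma subalgebra_span3 {R : realType} {n : nat} (u v w : 'M[R]_n) :
  lie u v \in <<[:: u; v; w]>>%VS -> lie u w \in <<[:: u; v; w]>>%VS ->
  lie v w \in <<[:: u; v; w]>>%VS -> subalgebra <<[:: u; v; w]>>.
Proof.
move=> uv uw vw X Y /mem_span3[a [b [c ->]]] /mem_span3[a' [b' [c' ->]]].
rewrite !(lieDl, lieDr, lieZl, lieZr) !liexx.
rewrite (lieC v u) (lieC w u) (lieC w v).
by rewrite !rpredD ?rpredZ ?rpredN ?mem0v.
Qed.

Lemma lie_Ad {R : realType} {n : nat} (x X Y : 'M[R]_n) :
  x \in unitmx -> lie (Ad x X) (Ad x Y) = Ad x (lie X Y).
Proof.
move=> xU; rewrite /lie /Ad mulmxBr mulmxBl !mulmxA.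
by rewrite !(mulmxKV xU).
Qed.

Lemma AdK {R : realType} {n : nat} {x : 'M[R]_n} (X : 'M[R]_n) :
  x \in unitmx -> invmx x *m Ad x X *m x = X.
Proof. by move=> xU; rewrite /Ad !mulmxA mulVmx// mul1mx mulmxKV. Qed.

(** [Ad x] preserves brackets and is injective, so a bracket that lands in [h'] comes from an
    element of [h]. *)
Lemma conjugate_subalgebra {R : realType} {n : nat} {G : set 'M[R]_n}
    {h h' : {vspace 'M[R]_n}} :
  (forall x, G x -> x \in unitmx) -> conjugate G h h' ->
  subalgebra h' -> subalgebra h.
Proof.
move=> GU [x /GU xU hh'] h'A X Y Xh Yh.
have AdP Z : Z \in h -> Ad x Z \in h'.
  by move=> Zh; have : [set` h'] (Ad x Z) by rewrite hh'; exists Z.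
have : [set` h'] (Ad x (lie X Y)) by rewrite /= -lie_Ad//; apply: h'A; exact: AdP.
by rewrite hh' => -[Z Zh AdZ]; rewrite -(AdK (lie X Y) xU) -AdZ AdK.
Qed.

(** Only one inclusion has to be checked: [Ad x] is linear and injective, so the image of [h] has
    dimension [size s], which bounds the dimension of the span of [s]. *)
Lemma conjugate_span {R : realType} {n : nat} {G : set 'M[R]_n}
    {h : {vspace 'M[R]_n}} (s : seq 'M[R]_n) {x : 'M[R]_n} :
  G x -> x \in unitmx -> size s = \dim h ->
  (forall X, X \in h -> Ad x X \in << s >>%VS) -> conjugate G h << s >>.
Proof.
move=> Gx xU sizes hs; exists x => //.
pose f := (mulmx x \o mulmxr (invmx x)) : 'M[R]_n -> 'M[R]_n.
have fE X : linfun f X = Ad x X by rewrite lfunE /f /= mulmxA.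
have hfs : (linfun f @: h = << s >>)%VS.
  apply/eqP; rewrite eqEdim; apply/andP; split.
    by apply/subvP => _ /memv_imgP[X Xh ->]; rewrite fE; exact: hs.
  rewrite limg_dim_eq -?sizes ?dim_span//.
  apply/eqP; rewrite -subv0; apply/subvP => X /memv_capP[_].
  rewrite memv_ker memv0 fE => /eqP AdX0.
  by rewrite -(AdK X xU) AdX0 mulmx0 mul0mx.
rewrite -hfs; apply/seteqP; split=> [_ /memv_imgP[X Xh ->]|_ [X Xh <-]] /=.
  by exists X; rewrite ?fE.
by rewrite -fE memv_img.
Qed.

(* [x] is the truncated series of [exp A]; as [A] commutes with [lie A X], the
   series of [exp (ad A)] applied to [X] stops after its linear term. *)
Lemma Ad_exp {R : realType} {n : nat} {A X x : 'M[R]_n} :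
  lie A X *m A *m A = 0 -> lie A (lie A X) = 0 -> x \in unitmx ->
  x = 1%:M + A + 2^-1 *: (A *m A) -> Ad x X = X + lie A X.
Proof.
set B := lie A X => BAA0 AB xU xE.
(* Clearing the inverse leaves polynomials in [A], [X] and [B]. Their expansions differ only by half
   of [B *m A *m A], which is zero by hypothesis. *)
suff xX : x *m X = (X + B) *m x by rewrite /Ad xX mulmxK.
have {}AB : A *m B = B *m A by apply/eqP; rewrite -subr_eq0; apply/eqP.
have AX : A *m X = X *m A + B by rewrite /B /lie addrC subrK.
clearbody B; have AAX : A *m A *m X = X *m A *m A + 2 *: (B *m A).
  by rewrite -mulmxA AX mulmxDr AB mulmxA AX mulmxDl -addrA scaler_nat mulr2n.
rewrite xE !(mulmxDl, mulmxDr) !mul1mx !mulmx1 -!scalemxAl -!scalemxAr.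
rewrite AAX AX !mulmxA BAA0.
move: (X *m A) (X *m A *m A) (B *m A) => XA XAA BA.
by apply/matrixP => i j; rewrite !mxE; field.
Qed.

(** * Tangent spaces of the two solvable groups and their unipotent elements *)

Lemma lie_algebra_entry0 {R : realType} {n : nat} {G : set 'M[R]_n} {X} i j k :
  lie_algebra G X -> (forall x, G x -> x i j = k) -> X i j = 0.
Proof.
move=> [c [Gc _ [dc <-]]] Gk; rewrite derive_mx// mxE.
have -> : (fun t => c t i j) = cst k by apply/funext => t; exact: Gk.
exact: derive_cst.
Qed.

Lemma unitmx_upper_triangular {K : fieldType} {n : nat} (x : 'M[K]_n) :
  (forall i j : 'I_n, (j < i)%N -> x i j = 0) -> (forall i, x i i != 0) ->
  x \in unitmx.
Proof.
(* [det_trig] concerns lower triangular matrices, hence the transpose. *)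
move=> xT xD; rewrite unitmxE -det_tr det_trig.
  by rewrite unitfE; apply/prodf_neq0 => i _; rewrite mxE.
by apply/is_trig_mxP => i j ij; rewrite mxE xT.
Qed.

Lemma Sol1_unitmx {R : realType} (x : 'M[R]_3) : Sol1 x -> x \in unitmx.
Proof.
move=> [t [a [b [c ->]]]]; apply: unitmx_upper_triangular.
  by move=> [[|[|[|//]]] ?] [[|[|[|//]]] ?] //= _; rewrite mxE.
by move=> [[|[|[|//]]] ?]; rewrite mxE/= ?oner_eq0// gt_eqF// expR_gt0.
Qed.

Lemma Sollam_unitmx {R : realType} (lambda : R) (x : 'M[R]_4) :
  Sollam lambda x -> x \in unitmx.
Proof.
move=> [t [a [b [c ->]]]]; apply: unitmx_upper_triangular.
  by move=> [[|[|[|[|//]]]] ?] [[|[|[|[|//]]]] ?] //= _; rewrite mxE.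
by move=> [[|[|[|[|//]]]] ?]; rewrite mxE/= ?oner_eq0// gt_eqF// expR_gt0.
Qed.

Lemma Sol1_lie_algebra {R : realType} (X : 'M[R]_3) :
  lie_algebra (@Sol1 R) X -> exists t a b c,
    X = mx_of_rows [:: [:: 0; a; c]; [:: 0; t; b]; [:: 0; 0; 0]].
Proof.
move=> XG; exists (X 1 1), (X 0 1), (X 1 2), (X 0 2); apply/matrixP.
move=> [[|[|[|//]]] ?] [[|[|[|//]]] ?]; rewrite mxE/=;
  try (by congr (X _ _); apply: val_inj);
  (* The entries left are (0,0), (1,0), (2,0), (2,1) and (2,2), with the constant values 1, 0, 0, 0,
     1 on the group. *)
  [apply: (lie_algebra_entry0 _ _ 1 XG) | apply: (lie_algebra_entry0 _ _ 0 XG)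
  |apply: (lie_algebra_entry0 _ _ 0 XG) | apply: (lie_algebra_entry0 _ _ 0 XG)
  |apply: (lie_algebra_entry0 _ _ 1 XG)];
  by move=> _ [t [a [b [c ->]]]]; rewrite mxE.
Qed.

(** The shape recorded is a diagonal linear part with a translation column; the commutator of two
    such matrices is a pure translation. *)
Lemma Sollam_lie_algebra {R : realType} (lambda : R) (X : 'M[R]_4) :
  lie_algebra (Sollam lambda) X -> exists p q r a b c,
    X = mx_of_rows [:: [:: p; 0; 0; a]; [:: 0; q; 0; b];
                       [:: 0; 0; r; c]; [:: 0; 0; 0; 0]].
Proof.
move=> XG; exists (X 0 0), (X 1 1), (X 2 2), (X 0 3), (X 1 3), (X 2 3).
apply/matrixP => -[[|[|[|[|//]]]] ?] [[|[|[|[|//]]]] ?]; rewrite mxE/=;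
  try (by congr (X _ _); apply: val_inj);
  (* The constant is 1 at the corner (3,3) and 0 at the other entries; [+] backtracks to the right
     one. *)
  (apply: (lie_algebra_entry0 _ _ 0 XG) + apply: (lie_algebra_entry0 _ _ 1 XG));
  by move=> _ [t [a [b [c ->]]]]; rewrite mxE.
Qed.

(** A commutator of tangent vectors is strictly upper triangular, so its exponential is a quadratic
    polynomial and lies in the group. This gives [Ad x] as [1 + ad A] wherever the square of [ad A]
    vanishes. *)
Lemma Sol1_Ad {R : realType} (Y Z : 'M[R]_3) :
  lie_algebra (@Sol1 R) Y -> lie_algebra (@Sol1 R) Z ->
  exists2 x, Sol1 x & forall X, lie_algebra (@Sol1 R) X ->
    lie (lie Y Z) (lie (lie Y Z) X) = 0 -> Ad x X = X + lie (lie Y Z) X.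
Proof.
move=> /Sol1_lie_algebra[t [a [b [c ->]]]].
move=> /Sol1_lie_algebra[t' [a' [b' [c' ->]]]].
set A := lie _ _.
pose u := a * t' - a' * t; pose v := t * b' - t' * b; pose w := a * b' - a' * b.
have AE : A = mx_of_rows [:: [:: 0; u; w]; [:: 0; 0; v]; [:: 0; 0; 0]].
  apply/matrixP => -[[|[|[|//]]] ?] [[|[|[|//]]] ?];
  by rewrite !mxE !big_ord_recl !big_ord0 !mxE/= /u /v /w; ring.
clearbody A u v w.
(* This is [1 + A + A^2 / 2], the term [u * v / 2] coming from the square; [expR 0] fits the group
   pattern at [t = 0]. *)
pose x := mx_of_rows [:: [:: 1; u; w + u * v / 2]; [:: 0; expR 0; v];
                         [:: 0; 0; 1]] : 'M[R]_3.
have Gx : Sol1 x by exists 0, u, v, (w + u * v / 2).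
exists x => // X /Sol1_lie_algebra[t'' [a'' [b'' [c'' XE]]]] AAX.
apply: Ad_exp => //; last 2 first.
- exact: Sol1_unitmx.
- rewrite AE; apply/matrixP => -[[|[|[|//]]] ?] [[|[|[|//]]] ?];
  by rewrite !mxE !big_ord_recl !big_ord0 !mxE/= ?expR0; field.
(* Both [A] and [lie A X] are strictly upper triangular of size 3, so a product of three of them
   vanishes. *)
rewrite -mulmxA (_ : A *m A = mx_of_rows
   [:: [:: 0; 0; u * v]; [:: 0; 0; 0]; [:: 0; 0; 0]]); last first.
  rewrite AE; apply/matrixP => -[[|[|[|//]]] ?] [[|[|[|//]]] ?];
  by rewrite !mxE !big_ord_recl !big_ord0 !mxE/=; ring.
rewrite (_ : lie A X = mx_of_rows
  [:: [:: 0; u * t''; u * b'' - a'' * v]; [:: 0; 0; - (t'' * v)];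
      [:: 0; 0; 0]]); last first.
  rewrite AE XE; apply/matrixP => -[[|[|[|//]]] ?] [[|[|[|//]]] ?];
  by rewrite !mxE !big_ord_recl !big_ord0 !mxE/=; ring.
apply/matrixP => -[[|[|[|//]]] ?] [[|[|[|//]]] ?];
by rewrite !mxE !big_ord_recl !big_ord0 !mxE/=; ring.
Qed.

(** Here the commutator is an infinitesimal translation of square zero, and its exponential is the
    translation [1 + A]. *)
Lemma Sollam_Ad {R : realType} (lambda : R) (Y Z : 'M[R]_4) :
  lie_algebra (Sollam lambda) Y -> lie_algebra (Sollam lambda) Z ->
  exists2 x, Sollam lambda x & forall X, lie_algebra (Sollam lambda) X ->
    lie (lie Y Z) (lie (lie Y Z) X) = 0 -> Ad x X = X + lie (lie Y Z) X.
Proof.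
move=> /Sollam_lie_algebra[p [q [r [a [b [c ->]]]]]].
move=> /Sollam_lie_algebra[p' [q' [r' [a' [b' [c' ->]]]]]].
set A := lie _ _.
pose u := p * a' - p' * a; pose v := q * b' - q' * b; pose w := r * c' - r' * c.
have AE : A = mx_of_rows [:: [:: 0; 0; 0; u]; [:: 0; 0; 0; v];
                             [:: 0; 0; 0; w]; [:: 0; 0; 0; 0]].
  apply/matrixP => -[[|[|[|[|//]]]] ?] [[|[|[|[|//]]]] ?];
  by rewrite !mxE !big_ord_recl !big_ord0 !mxE/= /u /v /w; ring.
clearbody A u v w.
pose x := mx_of_rows [:: [:: expR (lambda * 0); 0; 0; u];
  [:: 0; expR 0; 0; v]; [:: 0; 0; expR (- ((lambda + 1) * 0)); w];
  [:: 0; 0; 0; 1]] : 'M[R]_4.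
have Gx : Sollam lambda x by exists 0, u, v, w.
have AA : A *m A = 0.
  rewrite AE; apply/matrixP => -[[|[|[|[|//]]]] ?] [[|[|[|[|//]]]] ?];
  by rewrite !mxE !big_ord_recl !big_ord0 !mxE/=; ring.
exists x => // X _ AAX; apply: Ad_exp => //.
- by rewrite -mulmxA AA mulmx0.
- exact: Sollam_unitmx Gx.
- rewrite AA scaler0 addr0 AE.
  apply/matrixP => -[[|[|[|[|//]]]] ?] [[|[|[|[|//]]]] ?];
  by rewrite !mxE/= ?mulr0 ?oppr0 ?expR0; ring.
Qed.

(** * Classification of the subalgebras in terms of [e1], [e2], [e3], [e4] *)

Lemma Nil4_subalgebraP {R : realType} {n : nat} {g h : {vspace 'M[R]_n}}
    {e1 e2 e3 e4 : 'M[R]_n} :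
  basis_of g [:: e1; e2; e3; e4] -> Nil4_brackets e1 e2 e3 e4 ->
  (h <= g)%VS -> \dim h = 3%N ->
  subalgebra h <-> exists a b : R, ~ (a = 0 /\ b = 0) /\
    h = <<[:: e1; e2; (a *: e3 + b *: e4)%R]>>%VS.
Proof.
move=> eB br hg dimh; split=> [hA|[a [b [_ ->]]]]; last first.
  have [[e12 [e13 e14]] [e23 [e24 _]]] := br.
  apply: subalgebra_span3; rewrite ?(lieDr, lieZr) ?(e12, e13, e14, e23, e24).
  - exact: mem0v.
  - by rewrite !scaler0 addr0 mem0v.
  - by rewrite scaler0 add0r memvZ// memv_span// inE eqxx.
have [f1 [f2 [f3 [f4 [fN0 memh]]]]] := hyperplane_covector eB hg dimh.
have f10 : f1 = 0.
  (* The vectors [f_j e_i - f_i e_j] lie in the kernel of f. For two of them sharing the index i,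
     the value of f on their bracket is, up to sign, [f_i] times a coefficient of the 3-form f /\
     df; here this gives [f1 ^+ 3]. The same pairs are used for all three algebras. *)
  have Xh : comb4 e1 e2 e3 e4 f2 (- f1) 0 0 \in h by rewrite memh; apply/eqP; ring.
  have Yh : comb4 e1 e2 e3 e4 f4 0 0 (- f1) \in h by rewrite memh; apply/eqP; ring.
  have := hA _ _ Xh Yh; rewrite (Nil4_lie br) memh => /eqP H.
  have : f1 ^+ 3 = 0 by rewrite -[RHS]H; ring.
  by move/eqP; rewrite expf_eq0 /= => /eqP.
have f20 : f2 = 0.
  have Xh : comb4 e1 e2 e3 e4 0 f3 (- f2) 0 \in h by rewrite memh; apply/eqP; ring.
  have Yh : comb4 e1 e2 e3 e4 0 f4 0 (- f2) \in h by rewrite memh; apply/eqP; ring.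
  have := hA _ _ Xh Yh; rewrite (Nil4_lie br) memh => /eqP H.
  have : f2 ^+ 3 = 0 by rewrite -[RHS]H f10; ring.
  by move/eqP; rewrite expf_eq0 /= => /eqP.
(* The vector [f4 e3 - f3 e4] spans the kernel of f inside the plane of [e3] and [e4]. *)
exists f4, (- f3); split.
  by move=> [f40 /eqP]; rewrite oppr_eq0 => /eqP f30; apply: fN0.
apply/eqP; rewrite eqEdim dimh dim_span andbT; apply/subvP => y yh.
have [y1 [y2 [y3 [y4 yE]]]] := basis4P eB (subvP hg _ yh).
move: yh; rewrite yE memh f10 f20 !mulr0 !add0r => /eqP yf.
apply/mem_span3; rewrite /comb4.
suff [k [-> ->]] : exists k, y3 = k * f4 /\ y4 = - (k * f3).
  exists y1, y2, k.
  by rewrite scalerDr !scalerA mulrN addrA.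
(* The factor [k] is read off by dividing by whichever of [f3], [f4] is nonzero. *)
have [f30|f3N0] := eqVneq f3 0.
  have f4N0 : f4 != 0 by apply/eqP => f40; apply: fN0.
  exists (y3 / f4); split; first by field.
  by apply: (mulIf f4N0); rewrite f30 mulr0 oppr0 mul0r -yf f30; ring.
exists (- (y4 / f3)); split; last by field.
apply: (mulIf f3N0); rewrite (_ : y3 * f3 = - (y4 * f4)); first by field.
by apply/eqP; rewrite -addr_eq0 yf.
Qed.

(** Common form of the conjugation step for both solvable groups. Writing [A] as a bracket makes its
    exponential available in [G], and the vanishing of the square of [ad A] on [h] turns [Ad x] into
    the explicit map [X + lie A X]. *)
Lemma conjugate_span_exp {R : realType} {n : nat} {G : set 'M[R]_n}
    {g h : {vspace 'M[R]_n}} (s : seq 'M[R]_n) (A Y Z : 'M[R]_n) :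
  [set` g] = lie_algebra G ->
  (forall x, G x -> x \in unitmx) ->
  (forall Y Z, lie_algebra G Y -> lie_algebra G Z ->
    exists2 x, G x & forall X, lie_algebra G X ->
      lie (lie Y Z) (lie (lie Y Z) X) = 0 -> Ad x X = X + lie (lie Y Z) X) ->
  A = lie Y Z -> Y \in g -> Z \in g -> (h <= g)%VS -> size s = \dim h ->
  (forall X, X \in h -> lie A (lie A X) = 0 /\ X + lie A X \in << s >>%VS) ->
  conjugate G h << s >>.
Proof.
move=> gE GU GAd -> Yg Zg hg sizes hs.
have gG X : X \in g -> lie_algebra G X by move=> Xg; rewrite -gE.
have [x Gx AdE] := GAd _ _ (gG _ Yg) (gG _ Zg).
apply: (conjugate_span _ Gx (GU _ Gx) sizes) => X Xh.
have [AAX AX] := hs _ Xh.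
by rewrite AdE//; apply/gG/(subvP hg).
Qed.

Lemma Sol1_subalgebraP {R : realType} {g h : {vspace 'M[R]_3}}
    {e1 e2 e3 e4 : 'M[R]_3} :
  [set` g] = lie_algebra (@Sol1 R) ->
  basis_of g [:: e1; e2; e3; e4] -> Sol1_brackets e1 e2 e3 e4 ->
  (h <= g)%VS -> \dim h = 3%N ->
  subalgebra h <->
  [\/ conjugate (@Sol1 R) h <<[:: e1; e2; e3]>>%VS,
      conjugate (@Sol1 R) h <<[:: e1; e2; e4]>>%VS |
      conjugate (@Sol1 R) h <<[:: e1; e4; e3]>>%VS].
Proof.
move=> gE eB br hg dimh; have [[e12 [e13 e14]] [e23 [e24 e34]]] := br.
split=> [hA|]; last first.
  by move=> [] /(conjugate_subalgebra Sol1_unitmx); apply;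
    apply: subalgebra_span3;
    rewrite ?(e12, e13, e14, e23, e24, e34) ?(lieC e4, e34) ?rpredN ?mem0v//;
    apply: memv_span; rewrite !inE eqxx ?orbT.
have [f1 [f2 [f3 [f4 [fN0 memh]]]]] := hyperplane_covector eB hg dimh.
have f10 : f1 = 0.
  have Xh : comb4 e1 e2 e3 e4 f2 (- f1) 0 0 \in h by rewrite memh; apply/eqP; ring.
  have Yh : comb4 e1 e2 e3 e4 f3 0 (- f1) 0 \in h by rewrite memh; apply/eqP; ring.
  have := hA _ _ Xh Yh; rewrite (Sol1_lie br) memh => /eqP H.
  have : f1 ^+ 3 = 0 by rewrite -[RHS]H; ring.
  by move/eqP; rewrite expf_eq0 /= => /eqP.
have /eqP : f2 ^+ 2 * f3 = 0.
  have Xh : comb4 e1 e2 e3 e4 0 f3 (- f2) 0 \in h by rewrite memh; apply/eqP; ring.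
  have Yh : comb4 e1 e2 e3 e4 0 f4 0 (- f2) \in h by rewrite memh; apply/eqP; ring.
  (* The value of f on the bracket is [2 * f2 ^+ 2 * f3]: the contributions of [e2] and [e3] add up
     because [ad e4] has opposite eigenvalues on them. *)
  have := hA _ _ Xh Yh; rewrite (Sol1_lie br) memh f10 => /eqP H; lra.
rewrite mulf_eq0 expf_eq0 /= => f23.
have yP y : y \in h -> exists y1 y2 y3 y4,
    y = comb4 e1 e2 e3 e4 y1 y2 y3 y4 /\ y2 * f2 + y3 * f3 + y4 * f4 = 0.
  move=> yh; have [y1 [y2 [y3 [y4 yE]]]] := basis4P eB (subvP hg _ yh).
  exists y1, y2, y3, y4; split=> //.
  by move: yh; rewrite yE memh f10 mulr0 add0r => /eqP.
have [e2g [e3g e4g]] : e2 \in g /\ e3 \in g /\ e4 \in g.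
  by do !split; apply: (basis_mem eB); rewrite !inE eqxx ?orbT.
have conj s A Y Z := conjugate_span_exp (h := h) s A Y Z gE Sol1_unitmx Sol1_Ad.
have [f30|f3N0] := eqVneq f3 0; have [f20|f2N0] := eqVneq f2 0.
(* Now f is a multiple of the [e4]-coordinate, so [h] is already the model and [A = 0] gives
   conjugation by the identity. *)
- constructor 1; apply: (conj _ 0 0 0); rewrite ?mem0v ?liexx//.
  move=> y /yP[y1 [y2 [y3 [y4 [yE yf]]]]].
  have f4N0 : f4 != 0 by apply/eqP => f40; apply: fN0.
  have y40 : y4 = 0.
    by apply: (mulIf f4N0); rewrite mul0r -[RHS]yf f20 f30; ring.
  rewrite /lie !mul0mx !mulmx0 subrr; split=> //.
  apply/mem_span3; exists y1, y2, y3; rewrite yE y40 /comb4.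
  by rewrite scale0r !addr0.
- constructor 3.
  (* On [h] one has [y2 = s * y4], while [ad (s e2)] contributes [- s * y4] to the [e2]-coordinate,
     which therefore becomes zero. Since [[e2, e4] = - e2], the vector [s e2] is the bracket of
     [- s e2] and [e4]. *)
  pose s := - (f4 / f2).
  apply: (conj _ (comb4 e1 e2 e3 e4 0 s 0 0) (- s *: e2) e4); rewrite ?memvZ//.
    by rewrite lieZl e24 /comb4; apply/matrixP => i j; rewrite !mxE; ring.
  move=> y /yP[y1 [y2 [y3 [y4 [yE yf]]]]]; rewrite yE !(Sol1_lie br).
  have -> : y2 = s * y4.
    apply: (mulIf f2N0); rewrite /s (_ : y2 * f2 = - (y4 * f4)); first by field.
    by move: yf; rewrite f30; lra.
  split; first by rewrite /comb4; apply/matrixP => i j; rewrite !mxE; ring.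
  apply/mem_span3; exists (y1 + s * y3), y4, y3.
  by rewrite /comb4; apply/matrixP => i j; rewrite !mxE; ring.
- constructor 2.
  (* The sign is opposite to the previous case because [[e3, e4] = e3]. *)
  pose s := f4 / f3.
  apply: (conj _ (comb4 e1 e2 e3 e4 0 0 s 0) (s *: e3) e4); rewrite ?memvZ//.
    by rewrite lieZl e34 /comb4; apply/matrixP => i j; rewrite !mxE; ring.
  move=> y /yP[y1 [y2 [y3 [y4 [yE yf]]]]]; rewrite yE !(Sol1_lie br).
  have -> : y3 = - (s * y4).
    apply: (mulIf f3N0); rewrite /s (_ : y3 * f3 = - (y4 * f4)); first by field.
    by move: yf; rewrite f20; lra.
  split; first by rewrite /comb4; apply/matrixP => i j; rewrite !mxE; ring.
  apply/mem_span3; exists (y1 - s * y2), y2, y4.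
  by rewrite /comb4; apply/matrixP => i j; rewrite !mxE; ring.
- by move: f23; rewrite (negbTE f2N0) (negbTE f3N0).
Qed.

Lemma Sollam_subalgebraP {R : realType} {lambda : R} {g h : {vspace 'M[R]_4}}
    {e1 e2 e3 e4 : 'M[R]_4} :
  1 < lambda -> [set` g] = lie_algebra (Sollam lambda) ->
  basis_of g [:: e1; e2; e3; e4] -> Sollam_brackets lambda e1 e2 e3 e4 ->
  (h <= g)%VS -> \dim h = 3%N ->
  subalgebra h <->
  [\/ conjugate (Sollam lambda) h <<[:: e1; e2; e3]>>%VS,
      conjugate (Sollam lambda) h <<[:: e1; e2; e4]>>%VS,
      conjugate (Sollam lambda) h <<[:: e1; e3; e4]>>%VS |
      conjugate (Sollam lambda) h <<[:: e2; e3; e4]>>%VS].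
Proof.
move=> lambda1 gE eB br hg dimh; have [[e12 [e13 e14]] [e23 [e24 e34]]] := br.
split=> [hA|]; last first.
  by move=> [] /(conjugate_subalgebra (Sollam_unitmx lambda)); apply;
    apply: subalgebra_span3;
    rewrite ?(e12, e13, e14, e23, e24, e34) ?rpredN ?memvZ ?mem0v//;
    apply: memv_span; rewrite !inE eqxx ?orbT.
have [f1 [f2 [f3 [f4 [fN0 memh]]]]] := hyperplane_covector eB hg dimh.
(* The factors met below are differences of the eigenvalues [lambda], [1], [- (lambda + 1)] of
   [ad e4] on the span of [e1], [e2], [e3]: they are [lambda - 1], [2 lambda + 1] and [lambda + 2],
   all positive as [lambda > 1]. *)
have [lambda0 [lambda10 [lambda20 lambda30]]] : lambda != 0 /\ lambda + 1 != 0 /\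
    lambda - 1 != 0 /\ lambda + 2 != 0.
  by do !split; apply: lt0r_neq0; lra.
have f12 : (f1 == 0) || (f2 == 0).
  have Xh : comb4 e1 e2 e3 e4 f2 (- f1) 0 0 \in h by rewrite memh; apply/eqP; ring.
  have Yh : comb4 e1 e2 e3 e4 f4 0 0 (- f1) \in h by rewrite memh; apply/eqP; ring.
  have := hA _ _ Xh Yh; rewrite (Sollam_lie br) memh => /eqP H.
  have : (lambda - 1) * (f1 ^+ 2 * f2) = 0 by rewrite -[RHS]H; ring.
  by move/eqP; rewrite mulf_eq0 (negbTE lambda20) mulf_eq0 expf_eq0.
have f13 : (f1 == 0) || (f3 == 0).
  have Xh : comb4 e1 e2 e3 e4 f3 0 (- f1) 0 \in h by rewrite memh; apply/eqP; ring.
  have Yh : comb4 e1 e2 e3 e4 f4 0 0 (- f1) \in h by rewrite memh; apply/eqP; ring.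
  have := hA _ _ Xh Yh; rewrite (Sollam_lie br) memh => /eqP H.
  have : (lambda + (lambda + 1)) * (f1 ^+ 2 * f3) = 0 by rewrite -[RHS]H; ring.
  have /negbTE l0 : lambda + (lambda + 1) != 0 by apply: lt0r_neq0; lra.
  by move/eqP; rewrite mulf_eq0 l0 mulf_eq0 expf_eq0.
have f23 : (f2 == 0) || (f3 == 0).
  have Xh : comb4 e1 e2 e3 e4 0 f3 (- f2) 0 \in h by rewrite memh; apply/eqP; ring.
  have Yh : comb4 e1 e2 e3 e4 0 f4 0 (- f2) \in h by rewrite memh; apply/eqP; ring.
  have := hA _ _ Xh Yh; rewrite (Sollam_lie br) memh => /eqP H.
  have : (lambda + 2) * (f2 ^+ 2 * f3) = 0 by rewrite -[RHS]H; ring.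
  by move/eqP; rewrite mulf_eq0 (negbTE lambda30) mulf_eq0 expf_eq0.
have yP y : y \in h -> exists y1 y2 y3 y4,
    y = comb4 e1 e2 e3 e4 y1 y2 y3 y4 /\
    y1 * f1 + y2 * f2 + y3 * f3 + y4 * f4 = 0.
  move=> yh; have [y1 [y2 [y3 [y4 yE]]]] := basis4P eB (subvP hg _ yh).
  exists y1, y2, y3, y4; split=> //.
  by move: yh; rewrite yE memh => /eqP.
have [[e1g e2g] [e3g e4g]] : (e1 \in g /\ e2 \in g) /\ (e3 \in g /\ e4 \in g).
  by do !split; apply: (basis_mem eB); rewrite !inE eqxx ?orbT.
have conj s A Y Z := conjugate_span_exp (h := h) s A Y Z gE
  (Sollam_unitmx lambda) (Sollam_Ad lambda).
(* At most one of [f1], [f2], [f3] is nonzero, and its index is that of the vector missing from the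
   model. *)
have [f10|f1N0] := eqVneq f1 0; last first.
  move: f12 f13; rewrite (negbTE f1N0) /= => /eqP f20 /eqP f30.
  (* The eigenvalue enters twice: [ad (s e1)] shifts the first coordinate by [- lambda * s * y4],
     and [s e1] is the bracket of [- (s / lambda) e1] and [e4]. *)
  constructor 4; pose s := - (f4 / (lambda * f1)).
  apply: (conj _ (comb4 e1 e2 e3 e4 s 0 0 0) (- (s / lambda) *: e1) e4);
    rewrite ?memvZ//.
    by rewrite lieZl e14 /comb4; apply/matrixP => i j; rewrite !mxE; field.
  move=> y /yP[y1 [y2 [y3 [y4 [yE yf]]]]]; rewrite yE !(Sollam_lie br).
  have -> : y1 = lambda * s * y4.
    apply: (mulIf f1N0); rewrite /s (_ : y1 * f1 = - (y4 * f4)).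
      by field; rewrite f1N0.
    by move: yf; rewrite f20 f30; lra.
  split; first by rewrite /comb4; apply/matrixP => i j; rewrite !mxE; ring.
  apply/mem_span3; exists y2, y3, y4.
  by rewrite /comb4; apply/matrixP => i j; rewrite !mxE; ring.
have [f20|f2N0] := eqVneq f2 0; last first.
  move: f23; rewrite (negbTE f2N0) /= => /eqP f30.
  constructor 3; pose s := - (f4 / f2).
  apply: (conj _ (comb4 e1 e2 e3 e4 0 s 0 0) (- s *: e2) e4); rewrite ?memvZ//.
    by rewrite lieZl e24 /comb4; apply/matrixP => i j; rewrite !mxE; ring.
  move=> y /yP[y1 [y2 [y3 [y4 [yE yf]]]]]; rewrite yE !(Sollam_lie br).
  have -> : y2 = s * y4.
    apply: (mulIf f2N0); rewrite /s (_ : y2 * f2 = - (y4 * f4)); first by field.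
    by move: yf; rewrite f10 f30; lra.
  split; first by rewrite /comb4; apply/matrixP => i j; rewrite !mxE; ring.
  apply/mem_span3; exists y1, y3, y4.
  by rewrite /comb4; apply/matrixP => i j; rewrite !mxE; ring.
have [f30|f3N0] := eqVneq f3 0; last first.
  constructor 2; pose s := f4 / ((lambda + 1) * f3).
  apply: (conj _ (comb4 e1 e2 e3 e4 0 0 s 0) ((s / (lambda + 1)) *: e3) e4);
    rewrite ?memvZ//.
    by rewrite lieZl e34 /comb4; apply/matrixP => i j; rewrite !mxE; field.
  move=> y /yP[y1 [y2 [y3 [y4 [yE yf]]]]]; rewrite yE !(Sollam_lie br).
  have -> : y3 = - ((lambda + 1) * s * y4).
    apply: (mulIf f3N0); rewrite /s (_ : y3 * f3 = - (y4 * f4)).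
      by field; rewrite f3N0.
    by move: yf; rewrite f10 f20; lra.
  split; first by rewrite /comb4; apply/matrixP => i j; rewrite !mxE; ring.
  apply/mem_span3; exists y1, y2, y4.
  by rewrite /comb4; apply/matrixP => i j; rewrite !mxE; ring.
(* Only [f4] survives, so the conjugating element is again the identity. *)
constructor 1; apply: (conj _ 0 0 0); rewrite ?mem0v ?liexx//.
move=> y /yP[y1 [y2 [y3 [y4 [yE yf]]]]].
have f4N0 : f4 != 0 by apply/eqP => f40; apply: fN0.
have y40 : y4 = 0.
  by apply: (mulIf f4N0); rewrite mul0r -[RHS]yf f10 f20 f30; ring.
rewrite /lie !mul0mx !mulmx0 subrr; split=> //.
apply/mem_span3; exists y1, y2, y3; rewrite yE y40 /comb4.
by rewrite scale0r !addr0.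
Qed.

(** * From the basis [e_i] to the orthonormal basis [E_i] *)

Theorem theorem2p1 (R : realType) :
  (forall (g : {vspace 'M[R]_4}) (e1 e2 e3 e4 : 'M[R]_4)
          (d1 d2 d3 : R) (E1 E2 E3 E4 : 'M[R]_4)
          (rho : left_invariant_metric g) (h : {vspace 'M[R]_4}),
     [set` g] = lie_algebra (@Nil4 R) ->
     basis_of g [:: e1; e2; e3; e4] -> Nil4_brackets e1 e2 e3 e4 ->
     0 < d1 -> 0 < d3 -> 0 <= d2 ->
     E1 = d1 *: e1 ->
     E2 = d2 *: e1 + d3 *: e2 ->
     E3 = e3 ->
     E4 = e4 ->
     orthonormal_basis rho [:: E1; E2; E3; E4] ->
     (h <= g)%VS -> \dim h = 3%N ->
     subalgebra h <->
     exists a b : R, ~ (a = 0 /\ b = 0) /\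
       h = <<[:: E1; E2; (a *: E3 + b *: E4)%R]>>%VS)
  /\
  (forall (g : {vspace 'M[R]_3}) (e1 e2 e3 e4 : 'M[R]_3)
          (d1 d2 d3 d4 d5 : R) (E1 E2 E3 E4 : 'M[R]_3)
          (rho : left_invariant_metric g) (h : {vspace 'M[R]_3}),
     [set` g] = lie_algebra (@Sol1 R) ->
     basis_of g [:: e1; e2; e3; e4] -> Sol1_brackets e1 e2 e3 e4 ->
     0 < d1 -> 0 < d5 -> 0 <= d2 -> 0 <= d4 ->
     E1 = d1 *: e1 ->
     E2 = d2 *: e1 + e2 ->
     E3 = d3 *: e1 + d4 *: e2 + e3 ->
     E4 = d5 *: e4 ->
     orthonormal_basis rho [:: E1; E2; E3; E4] ->
     (h <= g)%VS -> \dim h = 3%N ->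
     subalgebra h <->
     [\/ conjugate (@Sol1 R) h <<[:: E1; E2; E3]>>%VS,
         conjugate (@Sol1 R) h <<[:: E1; E2; E4]>>%VS |
         conjugate (@Sol1 R) h
           <<[:: E1; E4; (1 / Num.sqrt (d4 ^+ 2 + 1)) *: (d4 *: E2 - E3)%R]>>%VS])
  /\
  (forall (m n : int) (lambda : R)
          (g : {vspace 'M[R]_4}) (e1 e2 e3 e4 : 'M[R]_4)
          (d1 d2 d3 d4 : R) (E1 E2 E3 E4 : 'M[R]_4)
          (rho : left_invariant_metric g) (h : {vspace 'M[R]_4}),
     Solmn_parameter m n lambda ->
     [set` g] = lie_algebra (Sollam lambda) ->
     basis_of g [:: e1; e2; e3; e4] -> Sollam_brackets lambda e1 e2 e3 e4 ->
     0 < d4 -> 0 <= d1 -> 0 <= d3 ->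
     E1 = e1 ->
     E2 = d1 *: e1 + e2 ->
     E3 = d2 *: e1 + d3 *: e2 + e3 ->
     E4 = d4 *: e4 ->
     orthonormal_basis rho [:: E1; E2; E3; E4] ->
     (h <= g)%VS -> \dim h = 3%N ->
     subalgebra h <->
     [\/ conjugate (Sollam lambda) h <<[:: E1; E2; E3]>>%VS,
         conjugate (Sollam lambda) h <<[:: E1; E2; E4]>>%VS,
         conjugate (Sollam lambda) h <<[:: E1; (d3 *: E2 - E3)%R; E4]>>%VS |
         conjugate (Sollam lambda) h
           <<[:: (d1 *: E1 - E2)%R; (d2 *: E1 - E3)%R; E4]>>%VS]).

Proof.
split=> [|]; last split.
- move=> g e1 e2 e3 e4 d1 d2 d3 E1 E2 E3 E4 rho h _ eB br d1_gt0 d3_gt0 _.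
  move=> E1E E2E -> -> _ hg dimh; rewrite (Nil4_subalgebraP eB br hg dimh).
  suff spanE a b : <<[:: E1; E2; (a *: e3 + b *: e4)%R]>>%VS =
      <<[:: e1; e2; (a *: e3 + b *: e4)%R]>>%VS.
    by split=> -[a [b [abN0 ->]]]; exists a, b; rewrite spanE.
  apply: (span3_triangular (b := 0) (c := 0) _ _ (oner_neq0 _) E1E E2E).
  + exact: lt0r_neq0.
  + exact: lt0r_neq0.
  + by rewrite !scale0r !add0r scale1r.
- move=> g e1 e2 e3 e4 d1 d2 d3 d4 d5 E1 E2 E3 E4 rho h gE eB br.
  move=> d1_gt0 d5_gt0 _ _ E1E E2E E3E E4E _ hg dimh.
  have d1N0 := lt0r_neq0 d1_gt0; have d5N0 := lt0r_neq0 d5_gt0.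
  have oneN0 := oner_neq0 R.
  rewrite (Sol1_subalgebraP gE eB br hg dimh).
  have -> : <<[:: E1; E2; E3]>>%VS = <<[:: e1; e2; e3]>>%VS.
    apply: (span3_triangular d1N0 oneN0 oneN0 E1E).
    + by rewrite scale1r E2E.
    + by rewrite scale1r E3E.
  have -> : <<[:: E1; E2; E4]>>%VS = <<[:: e1; e2; e4]>>%VS.
    apply: (span3_triangular (b := 0) (c := 0) d1N0 oneN0 d5N0 E1E).
    + by rewrite scale1r E2E.
    + by rewrite !scale0r !add0r E4E.
  suff -> : <<[:: E1; E4; (1 / Num.sqrt (d4 ^+ 2 + 1)) *: (d4 *: E2 - E3)%R]>>%VS
      = <<[:: e1; e4; e3]>>%VS by [].
  set k := 1 / _.
  have kN0 : - k != 0.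
    rewrite oppr_eq0 /k div1r invr_eq0 sqrtr_eq0 -ltNge.
    by rewrite ltr_wpDl ?sqr_ge0.
  (* The [e2]-terms cancel: [d4 E2 - E3 = (d4 d2 - d3) e1 - e3], so the diagonal coefficient is
     [- k]. *)
  apply: (span3_triangular (a := 0) (b := k * (d4 * d2 - d3)) (c := 0)
    d1N0 d5N0 kN0 E1E).
  + by rewrite scale0r add0r E4E.
  + by rewrite E2E E3E; apply/matrixP => i j; rewrite !mxE; ring.
- move=> m n lambda g e1 e2 e3 e4 d1 d2 d3 d4 E1 E2 E3 E4 rho h.
  move=> [_ [_ [_ [_ _ _ _ lambda_gt1]]]] gE eB br.
  move=> d4_gt0 _ _ E1E E2E E3E E4E _ hg dimh.
  have d4N0 := lt0r_neq0 d4_gt0; have oneN0 := oner_neq0 R.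
  have moneN0 : -1 != 0 :> R by rewrite oppr_eq0.
  have E1E' : E1 = 1 *: e1 by rewrite scale1r.
  rewrite (Sollam_subalgebraP lambda_gt1 gE eB br hg dimh).
  have -> : <<[:: E1; E2; E3]>>%VS = <<[:: e1; e2; e3]>>%VS.
    apply: (span3_triangular oneN0 oneN0 oneN0 E1E').
    + by rewrite scale1r E2E.
    + by rewrite scale1r E3E.
  have -> : <<[:: E1; E2; E4]>>%VS = <<[:: e1; e2; e4]>>%VS.
    apply: (span3_triangular (b := 0) (c := 0) oneN0 oneN0 d4N0 E1E').
    + by rewrite scale1r E2E.
    + by rewrite !scale0r !add0r E4E.
  have -> : <<[:: E1; (d3 *: E2 - E3)%R; E4]>>%VS = <<[:: e1; e3; e4]>>%VS.
    (* Again the [e2]-terms cancel, and [d3 E2 - E3 = (d3 d1 - d2) e1 - e3]. *)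
    apply: (span3_triangular (a := d3 * d1 - d2) (b := 0) (c := 0)
      oneN0 moneN0 d4N0 E1E').
    + by rewrite E2E E3E; apply/matrixP => i j; rewrite !mxE; ring.
    + by rewrite !scale0r !add0r E4E.
  suff -> : <<[:: (d1 *: E1 - E2)%R; (d2 *: E1 - E3)%R; E4]>>%VS =
      <<[:: e2; e3; e4]>>%VS by [].
  (* The [e1]-terms cancel: [d1 E1 - E2 = - e2] and [d2 E1 - E3 = - d3 e2 - e3]. *)
  apply: (span3_triangular (a := - d3) (b := 0) (c := 0) moneN0 moneN0 d4N0).
  + by rewrite E1E E2E; apply/matrixP => i j; rewrite !mxE; ring.
  + by rewrite E1E E3E; apply/matrixP => i j; rewrite !mxE; ring.
  + by rewrite !scale0r !add0r E4E.
Qed.
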